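(* Let $\{\Lambda_{x,j}: x\in\mathcal{X}, j\in J\}$ be a Parseval semi-continuous $g$-frame for a Hilbert space $\mathcal{H}$ with respect to a measure space $(\mathcal{X},\mu)$. Then for every $\mathcal{X}_1\subset\mathcal{X}$, with $\mathcal{X}_1^c=\mathcal{X}\setminus\mathcal{X}_1$, and every $f\in\mathcal{H}$, $$\int_{\mathcal{X}_1}\sum_{j\in J}\|\Lambda_{x,j}f\|^2\,d\mu(x)-\Big\|\int_{\mathcal{X}_1}\sum_{j\in J}\Lambda_{x,j}^*\Lambda_{x,j}f\,d\mu(x)\Big\|^2=\int_{\mathcal{X}_1^c}\sum_{j\in J}\|\Lambda_{x,j}f\|^2\,d\mu(x)-\Big\|\int_{\mathcal{X}_1^c}\sum_{j\in J}\Lambda_{x,j}^*\Lambda_{x,j}f\,d\mu(x)\Big\|^2.$$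
   Context: $\mathcal{H},\mathcal{K}$ are Hilbert spaces, $J$ is a countable index set, $(\mathcal{X},\mu)$ is a measure space with positive measure $\mu$, $\{\mathcal{K}_{x,j}:x\in\mathcal{X},j\in J\}$ is a family of Hilbert spaces contained in $\mathcal{K}$, and $\mathcal{L}(\mathcal{H},\mathcal{K}_{x,j})$ is the collection of all bounded linear operators from $\mathcal{H}$ into $\mathcal{K}_{x,j}$. A family $\{\Lambda_{x,j}\in\mathcal{L}(\mathcal{H},\mathcal{K}_{x,j}):x\in\mathcal{X},j\in J\}$ is a semi-continuous $g$-frame for $\mathcal{H}$ with respect to $(\mathcal{X},\mu)$ if for every $f\in\mathcal{H}$ and $j\in J$ the function $x\mapsto\Lambda_{x,j}(f)$ is measurable on $\mathcal{X}$, and there are constants $A,B>0$ (frame bounds) with $A\|f\|^2\le\int_{\mathcal{X}}\sum_{j\in J}\|\Lambda_{x,j}(f)\|^2d\mu(x)\le B\|f\|^2$ for all $f\in\mathcal{H}$. It is Parseval if the frame bounds are $A=B=1$. $\Lambda_{x,j}^*$ denotes the adjoint of $\Lambda_{x,j}$. *)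

(* Defs.v *)
From HB Require Import structures.
From mathcomp Require Import all_boot all_order all_algebra.
From mathcomp Require Import all_classical all_reals all_analysis.
From mathcomp.real_closed Require Import complex.
From mathcomp Require Import sesquilinear.

Set Implicit Arguments.
Unset Strict Implicit.
Unset Printing Implicit Defensive.

Import Order.TTheory GRing.Theory Num.Theory.
Import numFieldNormedType.Exports.

Local Open Scope classical_set_scope.
Local Open Scope ring_scope.
Local Open Scope complex_scope.

Reserved Notation "'<<|' x , y '|>>'" (at level 0, x, y at level 69,
  format "'<<|' x ,  y '|>>'").

(* Hilbert spaces are over either the reals or the complex numbers. *)
Variant scalar_kind := RealScalars | ComplexScalars.

Definition scalar_field (k : scalar_kind) (R : realType) : numFieldType :=
  match k with RealScalars => R | ComplexScalars => R[i] end.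

Definition sconj (k : scalar_kind) (R : realType) :
    scalar_field k R -> scalar_field k R :=
  match k with RealScalars => id | ComplexScalars => @conjc R end.

Definition sRe (k : scalar_kind) (R : realType) : scalar_field k R -> R :=
  match k with RealScalars => id | ComplexScalars => @complex.Re R end.

Definition sIm (k : scalar_kind) (R : realType) : scalar_field k R -> R :=
  match k with RealScalars => fun=> 0 | ComplexScalars => @complex.Im R end.

(* [{dot H for sconj}] is a positive definite form, linear in its first
   argument and [sconj]-linear in its second one. *)
HB.mixin Record CompleteNormedModule_isHilbert
    (k : scalar_kind) (R : realType) H
    of CompleteNormedModule (scalar_field k R) H := {
  inner : {dot H for @sconj k R} ;
  sqr_norm_inner : forall x : H, `|x| ^+ 2 = inner x x
}.

#[short(type="hilbertType")]
HB.structure Definition Hilbert (k : scalar_kind) (R : realType) :=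
  {H of CompleteNormedModule (scalar_field k R) H &
        CompleteNormedModule_isHilbert k R H}.

Notation "<<| x , y |>>" := (inner x y) : ring_scope.

(* `|x| lies in the scalar field, complex in the complex case. *)
Definition hnorm (k : scalar_kind) (R : realType) (H : hilbertType k R)
  (x : H) : R := sRe `|x|.

Record bounded_op (k : scalar_kind) (R : realType) (U V : hilbertType k R) :=
  BoundedOp {
    bounded_op_fun :> {linear U -> V} ;
    bounded_opP : exists C : R,
      forall u : U, hnorm (bounded_op_fun u) <= C * hnorm u
  }.

(* [U] is a Hilbert space contained in [V]: a linear isometry identifies it with
   a closed subspace of [V]. *)
Record hilbert_incl (k : scalar_kind) (R : realType) (U V : hilbertType k R) :=
  HilbertIncl {
    hilbert_incl_fun :> {linear U -> V} ;
    hilbert_inclP : forall u v : U,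
      <<| hilbert_incl_fun u, hilbert_incl_fun v |>> = <<| u, v |>>
  }.

(* Unique by positive definiteness, existing by the Riesz theorem. *)
Definition adjoint (k : scalar_kind) (R : realType) (U V : hilbertType k R)
    (T : bounded_op U V) (v : V) : U :=
  xget 0 [set w : U | forall u : U, <<| T u, v |>> = <<| u, w |>>].

(* [esum] is only meaningful for nonnegative families, hence the splitting. *)
Definition signed_esum (R : realType) (J : countType) (a : J -> R) : \bar R :=
  (\esum_(j in [set: J]) (EFin \o a)^\+ j -
   \esum_(j in [set: J]) (EFin \o a)^\- j)%E.

Section SumIntegrals.
Context d (X : measurableType d) (R : realType) (J : countType).
Variables (mu : {measure set X -> \bar R}) (D : set X).

Definition has_sum_integral (a : X -> J -> R) (r : R) : Prop :=
  mu.-integrable D (fun x => signed_esum (a x)) /\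
  (\int[mu]_(x in D) signed_esum (a x) = r%:E)%E.

Variables (k : scalar_kind) (H : hilbertType k R).

(* [v] is the weak (Pettis) value of the vector-valued integral over [D] of
   the sum over [j] of [F x j]:  for all [g], <<| v, g |>> is the integral of
   the sum of the <<| F x j, g |>>. *)
Definition is_weak_sum_integral (F : X -> J -> H) (v : H) : Prop :=
  forall g : H,
    has_sum_integral (fun x j => sRe <<| F x j, g |>>) (sRe <<| v, g |>>) /\
    has_sum_integral (fun x j => sIm <<| F x j, g |>>) (sIm <<| v, g |>>).

Definition weak_sum_integral (F : X -> J -> H) : H :=
  xget 0 [set v | is_weak_sum_integral F v].

End SumIntegrals.

(* Measurability with respect to the Borel sigma-algebra of [K]. *)
Definition borel_measurable_fun d (X : measurableType d)
    (k : scalar_kind) (R : realType) (K : hilbertType k R) (h : X -> K) : Prop :=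
  measurable_fun [set: X] (h : X -> g_sigma_algebraType (@open K)).

Section SemiContinuousGFrame.
Context d (X : measurableType d) (R : realType) (J : countType).
Variables (mu : {measure set X -> \bar R}) (k : scalar_kind).
Variables (H K : hilbertType k R) (Kxj : X -> J -> hilbertType k R).
Variable incl : forall x j, hilbert_incl (Kxj x j) K.
Variable L : forall x j, bounded_op H (Kxj x j).

Definition gframe_with_bounds (A B : R) : Prop :=
  [/\ forall (f : H) (j : J), borel_measurable_fun (fun x => incl x j (L x j f)),
      0 < A, 0 < B &
      forall f : H,
        ((A * hnorm f ^+ 2)%:E <=
          \int[mu]_(x in [set: X])
            (\esum_(j in [set: J]) (hnorm (L x j f) ^+ 2)%:E) <=
          (B * hnorm f ^+ 2)%:E)%E].

Definition semi_continuous_gframe : Prop :=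
  exists A B : R, gframe_with_bounds A B.

Definition parseval_semi_continuous_gframe : Prop := gframe_with_bounds 1 1.

End SemiContinuousGFrame.

(* Main.v *)
(* Let Q_D(h) be the integral over D of sum_j |Lambda_{x,j} h|^2. Polarizing
   this quadratic form gives a bounded additive functional
   g |-> int_D sum_j Re <Lambda f, Lambda g>, which the Riesz theorem represents
   by a vector v_D, the weak integral of Lambda^* Lambda f over D. Then
   Re <v_D, f> = Q_D(f), and the Parseval identity gives v_{X1} + v_{X1^c} = f.
   Hence Q_{X1}(f) - |v_{X1}|^2 = Re <v_{X1}, f - v_{X1}>
   = Re <v_{X1}, v_{X1^c}>, which is symmetric in X1 and its complement. *)

Require Import Defs.
From mathcomp Require Import all_boot all_order all_algebra.
From mathcomp Require Import all_classical all_reals all_analysis.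
From mathcomp Require Import measurable_realfun complex sesquilinear lra.

Import Order.TTheory GRing.Theory Num.Theory.
Import numFieldNormedType.Exports.
Local Open Scope classical_set_scope.
Local Open Scope ring_scope.

(** * Real and complex scalars treated uniformly *)

Section Scalars.
Context {k : scalar_kind} {R : realType}.
Implicit Types z w : scalar_field k R.

(** Turns imaginary parts into real parts: [sIm z] is the real part of [sconj sunit * z]. In the
    real case it is 0 because [sIm] vanishes there. *)
Definition sunit : scalar_field k R :=
  match k with RealScalars => 0 | ComplexScalars => 'i%C end.

Lemma sReD z w : sRe (z + w) = sRe z + sRe w.
Proof. by case: k z w => //= -[? ?] [? ?]. Qed.

Lemma sReN z : sRe (- z) = - sRe z.
Proof. by case: k z => //= -[? ?]. Qed.

Lemma sRe_conj z : sRe (sconj z) = sRe z.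
Proof. by case: k z => //= -[? ?]. Qed.

Lemma sIm_sReMconj z : sIm z = sRe (sconj sunit * z).
Proof.
rewrite /sunit; case: k z => //= [z|[a b]]; rewrite ?mul0r //=; simpc; lra.
Qed.

Lemma scalar_ext z w : sRe z = sRe w -> sIm z = sIm w -> z = w.
Proof. by case: k z w => //= -[? ?] [? ?] /= -> ->. Qed.

Lemma sRe_ge0 z : 0 <= z -> 0 <= sRe z.
Proof. by case: k z => //= -[? ?]; rewrite lecE => /andP[]. Qed.

Lemma sRe_gt0 z : 0 < z -> 0 < sRe z.
Proof. by case: k z => //= -[? ?]; rewrite ltcE => /andP[]. Qed.

(** Nonnegative elements of [R[i]] have zero imaginary part, so only their real parts are
    compared. *)
Lemma sRe_lt z w : 0 <= z -> 0 <= w -> (z < w) = (sRe z < sRe w).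
Proof.
case: k z w => //= -[a b] [c e]; rewrite !lecE !ltcE /=.
by move=> /andP[/eqP-> _] /andP[/eqP-> _]; rewrite eqxx.
Qed.

Lemma sReX2 z : 0 <= z -> sRe (z ^+ 2) = sRe z ^+ 2.
Proof.
case: k z => //= -[a b]; rewrite lecE /= => /andP[/eqP-> _].
by rewrite !expr2; simpc.
Qed.

Definition sreal (r : R) : scalar_field k R :=
  match k with RealScalars => r | ComplexScalars => r%:C%C end.

Lemma sReK r : sRe (sreal r) = r.
Proof. by rewrite /sreal; case: k. Qed.

Lemma sreal_gt0 r : (0 < sreal r) = (0 < r).
Proof. by rewrite /sreal; case: k => //=; rewrite ltcR. Qed.

Lemma sRe_sreal r z : sRe (sreal r * z) = r * sRe z.
Proof. by rewrite /sreal; case: k z => //= -[a b] /=; rewrite mul0r subr0. Qed.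

Lemma sreal_nat n : sreal n%:R = n%:R.
Proof. by rewrite /sreal; case: k => //=; rewrite rmorph_nat. Qed.

Lemma srealM r s : sreal (r * s) = sreal r * sreal s.
Proof. by rewrite /sreal; case: k => //=; rewrite rmorphM. Qed.
End Scalars.

(** * The underlying real inner product *)

Definition sdot {k R} {H : hilbertType k R} (x y : H) : R := sRe <<| x, y |>>.

Section Sdot.
Context {k : scalar_kind} {R : realType} {H : hilbertType k R}.
Implicit Types x y z : H.

Lemma sdotC x y : sdot x y = sdot y x.
Proof. by rewrite /sdot hermitian_subproof expr0 mul1r sRe_conj. Qed.

Lemma sdotDl x y z : sdot (x + y) z = sdot x z + sdot y z.
Proof. by rewrite /sdot linearDl sReD. Qed.

Lemma sdotNl x z : sdot (- x) z = - sdot x z.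
Proof. by rewrite /sdot linearNl sReN. Qed.

Lemma sdotDr x y z : sdot z (x + y) = sdot z x + sdot z y.
Proof. by rewrite !(sdotC z) sdotDl. Qed.

Lemma sdotNr x z : sdot z (- x) = - sdot z x.
Proof. by rewrite !(sdotC z) sdotNl. Qed.

Lemma sIm_inner x y : sIm <<| x, y |>> = sdot x (sunit *: y).
Proof. by rewrite sIm_sReMconj /sdot linearZr_LR. Qed.

Lemma hnorm_ge0 x : 0 <= hnorm x.
Proof. exact: sRe_ge0. Qed.

Lemma sqr_hnorm x : hnorm x ^+ 2 = sdot x x.
Proof. by rewrite /sdot -sqr_norm_inner sReX2. Qed.
End Sdot.

(** * Riesz representation by minimization *)

Section Riesz.
Context {k : scalar_kind} {R : realType} {H : hilbertType k R}.
Implicit Types x y z : H.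

Lemma sdotZl r x y : sdot (sreal r *: x) y = r * sdot x y.
Proof. by rewrite /sdot linearZl_LR sRe_sreal. Qed.

Lemma sdotZr r x y : sdot x (sreal r *: y) = r * sdot x y.
Proof. by rewrite !(sdotC x) sdotZl. Qed.

Lemma sreal_invnK n x : (sreal n.+1%:R^-1 *: x) *+ n.+1 = x.
Proof.
by rewrite -scaler_nat scalerA -sreal_nat -srealM mulfV// (sreal_nat 1) scale1r.
Qed.

Lemma sreal_halfD x : sreal 2^-1 *: (x + x) = x.
Proof. by rewrite scalerDr -mulr2n sreal_invnK. Qed.

Lemma hnorm_opp x : hnorm (- x) = hnorm x.
Proof. by rewrite /hnorm normrN. Qed.

Lemma sqr_hnormD x y :
  hnorm (x + y) ^+ 2 = hnorm x ^+ 2 + 2 * sdot x y + hnorm y ^+ 2.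
Proof. rewrite !sqr_hnorm !sdotDl !sdotDr (sdotC y x); lra. Qed.

Lemma sqr_hnormB x y :
  hnorm (x - y) ^+ 2 = hnorm x ^+ 2 - 2 * sdot x y + hnorm y ^+ 2.
Proof. by rewrite sqr_hnormD hnorm_opp sdotNr; lra. Qed.

Lemma sqr_hnormZ r x : hnorm (sreal r *: x) ^+ 2 = r ^+ 2 * hnorm x ^+ 2.
Proof. by rewrite !sqr_hnorm sdotZl sdotZr mulrA -expr2. Qed.

(** Expanding |x - e y|^2 >= 0 bounds 2 e Re <x, y> by |x|^2 + e^2 |y|^2, hence by e^2 (1 +
    |y|^2). *)
Lemma sdot_le e x y : 0 < e -> hnorm x <= e ->
  sdot x y <= e * (1 + hnorm y ^+ 2) / 2.
Proof.
move=> e0 xe; have := sqr_ge0 (hnorm (x - sreal e *: y)).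
rewrite sqr_hnormB sdotZr sqr_hnormZ.
have : hnorm x ^+ 2 <= e ^+ 2 by rewrite ler_sqr ?nnegrE ?hnorm_ge0// ltW.
set a := _ ^+ 2; set b := hnorm y ^+ 2; set c := sdot x y => a1 a2.
rewrite -(ler_pM2l e0); nra.
Qed.

Lemma hilbert_complete (u : nat -> H) :
  (forall e : R, 0 < e -> exists N, forall m n,
     (N <= m)%N -> (N <= n)%N -> hnorm (u m - u n) < e) ->
  exists v, forall e : R, 0 < e -> exists N, forall n,
     (N <= n)%N -> hnorm (v - u n) < e.
Proof.
move=> cu; have /cauchy_cvg/cvg_ex[v uv] : cauchy (u @ \oo).
  apply: cauchy_exP => e e0.
  have [N uN] := cu _ (sRe_gt0 _ e0).
  exists (u N), N => // n /= Nn.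
  by rewrite -ball_normE /= sRe_lt//; [exact: uN|exact: ltW].
exists v => e e0; have : (0 : scalar_field k R) < sreal e by rewrite sreal_gt0.
move/cvgrPdist_lt : uv => /[apply] -[N _ uN]; exists N => n /uN /=.
by rewrite sRe_lt ?sReK//; apply: ltW; rewrite sreal_gt0.
Qed.

(* Real homogeneity of [phi] is not assumed: the competitors in the minimization
   of [|x|^2 - 2 phi x] only involve the scalars 1/2 and 1/(n+1). *)
Lemma riesz (phi : H -> R) (M : R) :
  {morph phi : x y / x + y} ->
  (forall x, 2 * phi x <= M + hnorm x ^+ 2) ->
  exists v, forall x, sdot v x = phi x.
Proof.
move=> phiD phiM.
have phiN y : phi (- y) = - phi y.
  have := phiD y (- y); have := phiD 0 0; rewrite addr0 subrr; lra.
(* If v represents [phi], then F x = |x - v|^2 - |v|^2, so v is sought as the minimizer of [F]. *)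
pose F x := hnorm x ^+ 2 - 2 * phi x.
have F_inf : has_inf (range F).
  split; first by exists (F 0), 0.
  by exists (- M) => _ [x _ <-]; rewrite /F; have := phiM x; lra.
set m := inf (range F).
have mF x : m <= F x by apply: ge_inf; [exact: F_inf.2|exists x].
pose d n : R := n.+1%:R^-1.
have d0 n : 0 < d n by rewrite invr_gt0.
have dle i n : (i <= n)%N -> d n <= d i.
  by move=> ni; rewrite lef_pV2 ?posrE// ler_nat.
have /choice[u Fu] n : exists x, F x < m + d n ^+ 2.
  have [_ [x _ <-] Fx] := inf_adherent (exprn_gt0 2 (d0 n)) F_inf.
  by exists x.
have FB x y : hnorm (x - y) ^+ 2 <= 2 * (F x - m) + 2 * (F y - m).
  (* At the midpoint z, the parallelogram law gives |x - y|^2 = 2 F x + 2 F y - 4 F z, and F z >=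
     m. *)
  pose z := sreal 2^-1 *: (x + y).
  have zz : z + z = x + y by rewrite -scalerDr sreal_halfD.
  have phiz : phi z = (phi x + phi y) / 2 by rewrite -phiD -zz phiD; lra.
  have := mF z; rewrite /F phiz sqr_hnormZ sqr_hnormB sqr_hnormD; lra.
have d_small e : 0 < e -> exists n, d n < e.
  move=> e0; exists (Num.truncn e^-1).
  rewrite /d invf_plt ?posrE//; exact: truncnS_gt.
have [v uv] : exists v, forall e : R, 0 < e -> exists N, forall n,
     (N <= n)%N -> hnorm (v - u n) < e.
  apply: hilbert_complete => e e0.
  have [N dN] := d_small (e / 2) ltac:(lra).
  (* [FB] bounds the squared distance by 2 d_i^2 + 2 d_n^2 <= 4 d_N^2 < e^2. *)
  exists N => i n Ni Nn.
  rewrite -(ltr_pXn2r (ltn0Sn 1)) ?nnegrE ?hnorm_ge0 ?ltW//.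
  apply: le_lt_trans (FB _ _) _.
  have := Fu i; have := Fu n.
  have := dle _ _ Ni; have := dle _ _ Nn; have := d0 i; have := d0 n.
  nra.
(* Half of the bound is [sdot_le] for v - u_n; the other half compares the near-minimizer u_n with
   u_n - d_N x, where F is at least m. *)
have key N x : sdot v x - phi x <= d N * (1 + hnorm x ^+ 2).
  have [K uK] := uv _ (d0 N); pose n := maxn K N.
  have := sdot_le _ _ x (d0 N) (ltW (uK n (leq_maxl _ _))).
  rewrite sdotDl sdotNl.
  have := dle N n (leq_maxr _ _); have := d0 n; have := Fu n.
  have := mF (u n - sreal (d N) *: x).
  have phiZ : phi (sreal (d N) *: x) = d N * phi x.
    have phiMn y i : phi (y *+ i) = phi y *+ i.
      elim: i => [|i IH]; last by rewrite !mulrS phiD IH.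
      by have := phiD 0 0; rewrite !mulr0n addr0; lra.
    (* Additivity suffices: x is the sum of N + 1 copies of x / (N + 1). *)
    rewrite -[in RHS](sreal_invnK N x) phiMn -[phi _ *+ _]mulr_natl.
    by rewrite mulrA mulVf// mul1r.
  rewrite /F phiD phiN phiZ sqr_hnormB sdotZr sqr_hnormZ.
  have := d0 N; move: (hnorm x ^+ 2) (hnorm (u n) ^+ 2) (d n) (d N).
  move: (sdot v x) (sdot (u n) x) (phi x) (phi (u n)).
  move=> b a p q h u2 dn dN dN0 mF' Fu' dn0 dnN bN.
  have : dN * (a - p) <= dN * (dN * (1 + h) / 2) by nra.
  rewrite ler_pM2l//; lra.
have le x : sdot v x <= phi x.
  apply/ler_addgt0Pr => e e0.
  have h0 : 0 < 1 + hnorm x ^+ 2 by have := sqr_ge0 (hnorm x); lra.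
  have [N dN] := d_small (e / (1 + hnorm x ^+ 2)) (divr_gt0 e0 h0).
  by have := key N x; rewrite ltr_pdivlMr// in dN; lra.
exists v => x; apply/eqP; rewrite eq_le le/=.
by have := le (- x); rewrite sdotNr phiN; lra.
Qed.
End Riesz.

(** * Existence of adjoints *)

Section Adjoint.
Context {k : scalar_kind} {R : realType}.

Lemma sdot_conj {H : hilbertType k R} a (x y : H) :
  sdot x (a *: y) = sdot (sconj a *: x) y.
Proof. by rewrite /sdot linearZr_LR linearZl_LR. Qed.

(** Riesz applied to u |-> Re <T u, v> matches the real parts; linearity of [T] then moves [sunit]
    across to match the imaginary parts. *)
Lemma adjointP {U V : hilbertType k R} (T : bounded_op U V) (u : U) (v : V) :
  <<| T u, v |>> = <<| u, adjoint T v |>>.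
Proof.
suff [w Tw] : exists w, forall u, <<| T u, v |>> = <<| u, w |>>.
  by rewrite /adjoint; case: xgetP => [_ _ ->//|/(_ w)/=[]].
have [C TC] := bounded_opP T.
(* The summand 1 makes c positive, so that the expansion of |T x - c^2 v|^2 >= 0 can be divided by
   c^2. *)
pose c := `|C| + 1; have c0 : 0 < c by rewrite ltr_wpDl.
have [||w wP] := riesz (fun u => sdot (T u) v) (c ^+ 2 * hnorm v ^+ 2).
- by move=> x y /=; rewrite linearD sdotDl.
- move=> x /=.
  have Tx : hnorm (T x) <= c * hnorm x.
    apply: le_trans (TC x) _; rewrite ler_wpM2r ?hnorm_ge0//.
    by rewrite ler_wpDr// ler_norm.
  have {}Tx : hnorm (T x) ^+ 2 <= c ^+ 2 * hnorm x ^+ 2.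
    by rewrite -exprMn ler_sqr ?nnegrE ?mulr_ge0 ?hnorm_ge0// ltW.
  have c2 : 0 < c ^+ 2 by rewrite exprn_gt0.
  have := sqr_ge0 (hnorm (T x - sreal (c ^+ 2) *: v)).
  rewrite sqr_hnormB sdotZr sqr_hnormZ.
  by move=> ?; rewrite -(ler_pM2l c2); lra.
exists w => x; apply: scalar_ext.
  by rewrite -/(sdot _ _) -wP sdotC.
by rewrite !sIm_inner !sdot_conj -linearZ -wP sdotC.
Qed.
End Adjoint.

(** * Measurability and polarization tools *)

Lemma measurable_hnorm (k : scalar_kind) (R : realType) (K : hilbertType k R)
    d (X : measurableType d) (h : X -> K) :
  borel_measurable_fun h -> measurable_fun setT (fun x => hnorm (h x)).
Proof.
move=> mh; apply: (measurability _ (RGenOInfty.measurableE R)).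
move=> _ [_ [a ->] <-].
have -> : [set: X] `&` (fun x => hnorm (h x)) @^-1` `]a, +oo[ =
          [set: X] `&` h @^-1` [set y | a < hnorm y].
  by apply/seteqP; split => x /=; rewrite in_itv/= andbT.
apply: (mh measurableT); apply: sub_sigma_algebra.
rewrite openE => y /= ay; rewrite /interior.
(* By the triangle inequality the ball of radius |y| - a around y stays in the set. *)
apply/nbhs_ballP; exists (sreal (hnorm y - a)) => /=.
  by rewrite sreal_gt0 subr_gt0.
move=> z; rewrite -ball_normE /= sRe_lt// ?sReK; last first.
  by apply: ltW; rewrite sreal_gt0 subr_gt0.
have : hnorm y <= hnorm (y - z) + hnorm z.
  rewrite /hnorm -sReD -subr_ge0 -sReN -sReD; apply: sRe_ge0.
  by rewrite subr_ge0 -{1}(subrK z y) ler_normD.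
rewrite -/(hnorm (y - z)); lra.
Qed.

(** Reindexing along [pickle] turns the sum into a nonnegative series over nat, with zero terms at
    numbers that code no element of [J]. *)
Lemma measurable_fun_esum d (X : measurableType d) (R : realType)
    (J : countType) (D : set X) (a : X -> J -> \bar R) :
  (forall j, measurable_fun D (a^~ j)) -> (forall x j, 0 <= a x j)%E ->
  measurable_fun D (fun x => \esum_(j in [set: J]) a x j)%E.
Proof.
move=> ma a0.
pose c x n : \bar R := oapp (a x) 0%E (pickle_inv n).
have c0 x n : (0 <= c x n)%E by rewrite /c; case: (pickle_inv n) => /=.
have -> : (fun x => \esum_(j in [set: J]) a x j)%E =
          (fun x => \sum_(n <oo | n \in predT) c x n)%E.
  apply/funext => x; rewrite nneseries_esum//.
  rewrite [RHS](esumID (pickle @` [set: J])) ?set_true//.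
  rewrite !setTI [X in (_ + X)%E]esum1 ?adde0 => [|n /= nJ]; last first.
    rewrite /c; case E : (pickle_inv n) => [j|]//=; case: nJ; exists j => //.
    by have := @pickle_invK J n; rewrite E.
  rewrite esum_image; last by move=> i j _ _; exact: (pcan_inj pickleK_inv).
  by apply: eq_esum => j _; rewrite /c pickleK_inv.
apply: ge0_emeasurable_sum => [n x _ _|n _]//.
by rewrite /c; case: (pickle_inv n) => [j|]//=; exact: ma.
Qed.

(** Jordan-von Neumann argument: the identities at (f + g, h) and (f + h, g), minus those at (f - g,
    h) and (f - h, g), leave twice the claim. *)
Lemma parallelogram_additive (R : realFieldType) (V : zmodType)
    (p : V -> R) (f : V) :
  (forall a b, p (a + b) + p (a - b) = 2 * p a + 2 * p b) ->
  {morph (fun g => p (f + g) - p (f - g)) : x y / x + y}.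
Proof.
move=> pp g h /=.
have pN x : p (- x) = p x.
  by have := pp 0 x; have := pp 0 0; rewrite !add0r oppr0; lra.
have := pp (f + g) h; have := pp (f - g) h.
have := pp (f + h) g; have := pp (f - h) g.
have -> : f - h + g = f + g - h by rewrite addrAC.
have -> : f + h + g = f + g + h by rewrite addrAC.
have -> : f + h - g = f - g + h by rewrite addrAC.
have -> : f - h - g = f - g - h by rewrite addrAC.
have -> : f + (g + h) = f + g + h by rewrite addrA.
have -> : f - (g + h) = f - g - h by rewrite opprD addrA.
lra.
Qed.

(** * Energies and weak integrals over a measurable set *)

Section Frame.
Context {d} {X : measurableType d} {R : realType} {J : countType}
  {mu : {measure set X -> \bar R}} {k : scalar_kind} {H : hilbertType k R}
  {Kxj : X -> J -> hilbertType k R} {L : forall x j, bounded_op H (Kxj x j)}.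
Implicit Types (f g h : H) (D : set X).

Local Notation q h :=
  (fun x => \esum_(j in [set: J]) (hnorm (L x j h) ^+ 2)%:E)%E.

Hypothesis mL : forall h j, measurable_fun setT (fun x => hnorm (L x j h)).
Hypothesis parseval : forall h, (\int[mu]_x q h x = (hnorm h ^+ 2)%:E)%E.

(** For measurable [D], [fine] loses nothing: the Parseval identity bounds the integral by |h|^2. *)
Definition energy D h : R := fine (\int[mu]_(x in D) q h x)%E.

Lemma density_ge0 h x : (0 <= q h x)%E.
Proof. by apply: esum_ge0 => j _; rewrite lee_fin sqr_ge0. Qed.

Lemma measurable_density D h : measurable_fun D (q h).
Proof.
apply: (@measurable_funS _ _ _ _ setT) => //.
apply: measurable_fun_esum => [j|x j]; last by rewrite lee_fin sqr_ge0.
by apply/measurable_EFinP; exact: measurable_funX.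
Qed.

(** Free of subtractions of densities, the identity also holds where they are infinite. *)
Lemma density_parallelogram f g x :
  (q (f + g) x + q (f - g) x = q f x + q f x + (q g x + q g x))%E.
Proof.
have n0 h j : (0 <= (hnorm (L x j h) ^+ 2)%:E)%E by rewrite lee_fin sqr_ge0.
rewrite -!esumD//; last 2 first.
- by move=> j _; rewrite adde_ge0.
- by move=> j _; rewrite adde_ge0.
apply: eq_esum => j _; rewrite -!EFinD linearD linearB sqr_hnormD sqr_hnormB.
congr (_%:E); lra.
Qed.

Section Domain.
Variables (D : set X) (mD : measurable D).

Lemma integral_density_le h : (\int[mu]_(x in D) q h x <= (hnorm h ^+ 2)%:E)%E.
Proof.
rewrite -parseval; apply: ge0_subset_integral => //.
  exact: measurable_density.
by move=> x _; exact: density_ge0.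
Qed.

Lemma integral_density_ge0 h : (0 <= \int[mu]_(x in D) q h x)%E.
Proof. by apply: integral_ge0 => x _; exact: density_ge0. Qed.

Lemma energyE h : (\int[mu]_(x in D) q h x = (energy D h)%:E)%E.
Proof.
rewrite fineK// ge0_fin_numE ?integral_density_ge0//.
exact: le_lt_trans (integral_density_le h) (ltry _).
Qed.

Lemma energy_ge0 h : 0 <= energy D h.
Proof. by rewrite -lee_fin -energyE integral_density_ge0. Qed.

Lemma energy_le h : energy D h <= hnorm h ^+ 2.
Proof. by rewrite -lee_fin -energyE integral_density_le. Qed.

Lemma integrable_density h : mu.-integrable D (q h).
Proof.
apply/integrableP; split; first exact: measurable_density.
under eq_integral do rewrite gee0_abs ?density_ge0//.
by rewrite energyE ltry.
Qed.

Lemma energy_parallelogram f g :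
  energy D (f + g) + energy D (f - g) = 2 * energy D f + 2 * energy D g.
Proof.
apply: EFin_inj; rewrite EFinD -!energyE -ge0_integralD//; last 4 first.
- by move=> x _; exact: density_ge0.
- exact: measurable_density.
- by move=> x _; exact: density_ge0.
- exact: measurable_density.
under eq_integral do rewrite density_parallelogram.
have qq_ge0 h x : (0 <= q h x + q h x)%E by rewrite adde_ge0 ?density_ge0.
have mqq h : measurable_fun D (fun x => q h x + q h x)%E.
  by apply: emeasurable_funD; exact: measurable_density.
rewrite !ge0_integralD//; try (by move=> x _; exact: density_ge0);
  try exact: measurable_density.
rewrite !energyE -!EFinD; congr (_%:E); lra.
Qed.

(* Scaling the arguments rather than the values by the polarization factor makes
   the integrand a plain difference of two densities. *)
Definition polar D f g : R :=
  energy D (sreal 2^-1 *: (f + g)) - energy D (sreal 2^-1 *: (f - g)).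

Lemma polar_additive f : {morph polar D f : g h / g + h}.
Proof.
pose p h := energy D (sreal 2^-1 *: h).
apply: (@parallelogram_additive _ _ p) => a b; rewrite /p.
by rewrite scalerDr scalerBr energy_parallelogram.
Qed.

(** The bound that [riesz] asks for, with M = |f|^2. *)
Lemma polar_le f g : 2 * polar D f g <= hnorm f ^+ 2 + hnorm g ^+ 2.
Proof.
have := energy_le (sreal 2^-1 *: (f + g)).
have := energy_ge0 (sreal 2^-1 *: (f - g)).
have := sqr_ge0 (hnorm (f - g)).
rewrite sqr_hnormZ sqr_hnormB sqr_hnormD /polar; lra.
Qed.

Lemma polarff f : polar D f f = energy D f.
Proof.
rewrite /polar sreal_halfD subrr scaler0.
have -> : energy D 0 = 0; last by rewrite subr0.
apply: le_anti; rewrite energy_ge0 andbT; apply: le_trans (energy_le 0) _.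
by rewrite sqr_hnorm; have := sdotDl (0 : H) 0 0; rewrite addr0; lra.
Qed.

(** With u = (f + g) / 2 and v = (f - g) / 2, each term is |L u|^2 - |L v|^2. *)
Lemma has_sum_integral_polar f g :
  has_sum_integral mu D (fun x j => sdot (L x j f) (L x j g)) (polar D f g).
Proof.
set a := fun x j => sdot (L x j f) (L x j g).
set u := sreal 2^-1 *: (f + g); set v := sreal 2^-1 *: (f - g).
have aE x j : a x j = hnorm (L x j u) ^+ 2 - hnorm (L x j v) ^+ 2.
  rewrite /a; have -> : L x j f = L x j u + L x j v.
    rewrite -linearD -scalerDr addrACA subrr addr0.
    by rewrite sreal_halfD.
  have -> : L x j g = L x j u - L x j v.
    rewrite -linearB -scalerBr opprB [f + g]addrC addrACA subrr addr0.
    by rewrite sreal_halfD.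
  rewrite !sqr_hnorm sdotDl !sdotDr !sdotNr (sdotC (L x j v)); lra.
have ma j : measurable_fun D (EFin \o a^~ j).
  apply/measurable_EFinP; under eq_fun do rewrite aE.
  by apply: measurable_funB; apply: measurable_funX;
    apply: measurable_funS (mL _ _).
have ms : measurable_fun D (fun x => signed_esum (a x)).
  apply: emeasurable_funB.
    apply: (@measurable_fun_esum _ _ _ _ _ (fun x => (EFin \o a x)^\+%E)) => //.
    move=> j; apply: eq_measurable_fun (measurable_funepos (ma j)) => x _.
    by rewrite !funeposE.
  apply: (@measurable_fun_esum _ _ _ _ _ (fun x => (EFin \o a x)^\-%E)) => //.
  move=> j; apply: eq_measurable_fun (measurable_funeneg (ma j)) => x _.
  by rewrite !funenegE.
have iuv : mu.-integrable D (fun x => q u x + q v x)%E.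
  by apply: integrableD => //; exact: integrable_density.
have isum : mu.-integrable D (fun x => signed_esum (a x)).
  (* The positive part of each term is at most |L u|^2, the negative part at most |L v|^2. *)
  apply: le_integrable iuv => // x _.
  rewrite [leRHS]gee0_abs ?adde_ge0 ?density_ge0//.
  apply: le_trans (lee_abs_sub _ _) _; rewrite !gee0_abs ?esum_ge0//.
  apply: leeD; apply: le_esum => j _.
    rewrite funeposE ge_max /= !lee_fin sqr_ge0 andbT aE.
    by rewrite gerBl sqr_ge0.
  rewrite funenegE ge_max /= !lee_fin sqr_ge0 andbT aE.
  by rewrite opprB gerBl sqr_ge0.
split=> //.
(* The signed sum is split only where both densities are finite, hence almost everywhere. *)
rewrite (ae_eq_integral (q u \- q v)%E)//.
- by rewrite integralB ?integrable_density// !energyE.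
- by apply: emeasurable_funB; exact: measurable_density.
have := integrable_ae mD (integrable_density u).
have := integrable_ae mD (integrable_density v).
apply: filterS2 => x qv qu Dx; rewrite /signed_esum.
have sq h : q h x \is a fin_num ->
    summable [set: J] (fun j => (hnorm (L x j h) ^+ 2)%:E).
  rewrite summableE => qh; rewrite (_ : esum _ _ = q h x)//.
  by apply: eq_esum => j _; rewrite gee0_abs// lee_fin sqr_ge0.
rewrite -(esumB (sq _ (qu Dx)) (sq _ (qv Dx))).
- by have -> : EFin \o a x = ((fun j => (hnorm (L x j u) ^+ 2)%:E) \-
    (fun j => (hnorm (L x j v) ^+ 2)%:E))%E by apply/funext => j /=; rewrite aE.
- by move=> j _; rewrite lee_fin sqr_ge0.
- by move=> j _; rewrite lee_fin sqr_ge0.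
Qed.

(** The Riesz vector of [polar D f] is a weak integral, so [xget] does not fall back on its default
    0. *)
Lemma weak_sum_integralP f g :
  sdot (weak_sum_integral mu D (fun x j => adjoint (L x j) (L x j f))) g =
  polar D f g.
Proof.
set F := fun x j => _.
have FE h : (fun x j => sRe <<| F x j, h |>>) =
    fun x j => sdot (L x j f) (L x j h).
  apply/funext => x; apply/funext => j.
  by rewrite -/(sdot (F x j) h) sdotC [RHS]sdotC /sdot adjointP.
have [v vP] := riesz (polar D f) _ (polar_additive f) (polar_le f).
have : is_weak_sum_integral mu D F (weak_sum_integral mu D F).
  apply: (xgetPex 0); exists v => h.
  have vF g' :
      has_sum_integral mu D (fun x j => sRe <<| F x j, g' |>>) (sdot v g').
    by rewrite (FE g') vP; exact: has_sum_integral_polar.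
  split; first exact: vF.
  (* The imaginary condition at h is the real one at [sunit *: h]. *)
  rewrite sIm_inner.
  rewrite (_ : (fun x j => _) = fun x j => sRe <<| F x j, sunit *: h |>>)//.
  by apply/funext => x; apply/funext => j; exact: sIm_inner.
move=> /(_ g)[[_ iF] _]; have := has_sum_integral_polar f g.
by rewrite -(FE g) => -[_]; rewrite iF => -[].
Qed.
End Domain.

Lemma polarT f g : polar setT f g = sdot f g.
Proof.
have eT h : energy setT h = hnorm h ^+ 2 by rewrite /energy parseval.
rewrite /polar !eT !sqr_hnormZ sqr_hnormB sqr_hnormD; lra.
Qed.

Lemma energy_setC D h : measurable D ->
  energy D h + energy (~` D) h = energy setT h.
Proof.
move=> mD; have mDC := measurableC mD.
apply: EFin_inj; rewrite EFinD -!energyE// -ge0_integral_setU ?setUv//.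
- exact: measurable_density.
- by move=> x _; exact: density_ge0.
- exact/disj_setPCl.
Qed.
End Frame.

(** * The identity for complementary sets *)

Theorem theorem3p5 (R : realType) (k : scalar_kind) (H K : hilbertType k R)
    (J : countType) (d : measure_display) (X : measurableType d)
    (mu : {measure set X -> \bar R})
    (Kxj : X -> J -> hilbertType k R)
    (incl : forall (x : X) (j : J), hilbert_incl (Kxj x j) K)
    (L : forall (x : X) (j : J), bounded_op H (Kxj x j))
    (parseval_L : parseval_semi_continuous_gframe mu incl L)
    (X1 : set X) (measurable_X1 : measurable X1) (f : H) :
  (\int[mu]_(x in X1) (\esum_(j in [set: J]) (hnorm (L x j f) ^+ 2)%:E)
   - (hnorm (weak_sum_integral mu X1
               (fun x j => adjoint (L x j) (L x j f))) ^+ 2)%:E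
   =
   \int[mu]_(x in ~` X1) (\esum_(j in [set: J]) (hnorm (L x j f) ^+ 2)%:E)
   - (hnorm (weak_sum_integral mu (~` X1)
               (fun x j => adjoint (L x j) (L x j f))) ^+ 2)%:E)%E.
Proof.
have [mincl _ _ LAB] := parseval_L.
have mL h j : measurable_fun setT (fun x => hnorm (L x j h)).
  (* Measurability is given only after embedding into [K]; the embedding is isometric. *)
  have -> : (fun x => hnorm (L x j h)) = (fun x => hnorm (incl x j (L x j h))).
    apply/funext => x; apply/eqP.
    by rewrite -(eqrXn2 (ltn0Sn 1)) ?hnorm_ge0// !sqr_hnorm /sdot hilbert_inclP.
  exact: measurable_hnorm.
have parseval h : (\int[mu]_x (\esum_(j in [set: J]) (hnorm (L x j h) ^+ 2)%:E)
    = (hnorm h ^+ 2)%:E)%E.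
  by apply: le_anti; have := LAB h; rewrite mul1r andbC.
have mX1C := measurableC measurable_X1.
have := weak_sum_integralP mL parseval X1 measurable_X1 f.
have := weak_sum_integralP mL parseval _ mX1C f.
rewrite !(energyE mL parseval)// -!EFinB.
set v := weak_sum_integral mu X1 _; set w := weak_sum_integral mu (~` X1) _.
move=> wP vP; congr (_%:E).
pose pol D g := polar (mu := mu) (L := L) D f g.
have polarD g : pol X1 g + pol (~` X1) g = sdot f g.
  rewrite -(polarT parseval) /pol /polar -!(energy_setC mL parseval X1)//; lra.
rewrite -!(polarff mL parseval)// -vP -wP.
(* This is v + w = f in weak form; testing it at v and at w makes both sides of the goal equal to Re
   <v, w>. *)
have vwE g : sdot v g + sdot w g = sdot f g by rewrite vP wP polarD.
rewrite !sqr_hnorm.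
have := vwE v; have := vwE w; rewrite (sdotC w v) (sdotC f v) (sdotC f w); lra.
Qed.
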